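(* Let $I$ be a finite or countably infinite set. There is a function $f\in\mathcal{A}(D^I)$ such that for every point $\theta\in\mathbb{T}^I$ and every direction $v\in\mathbb{R}^I$ with $\|v\|_\infty=1$, both functions $u=\mathrm{Re} f|_{\mathbb{T}^I}$ and $\tilde u=\mathrm{Im} f|_{\mathbb{T}^I}$ are not differentiable at $\theta$ in the direction $v$. In fact, the class of such functions $f$ is residual in $\mathcal{A}(D^I)$, i.e. it contains a dense $G_\delta$ subset of $\mathcal{A}(D^I)$.
   Context: $D$ is the open unit disc in $\mathbb{C}$, $\overline{D}$ its closure, $\mathbb{T}$ the unit circle. $\overline{D}^I=\{(z_i)_{i\in I}: |z_i|\le 1 \text{ for every } i\in I\}$ carries the product (cartesian) topology. The polydisc algebra $\mathcal{A}(D^I)$ is the set of functions $f:\overline{D}^I\to\mathbb{C}$ that are continuous on $\overline{D}^I$ and separately holomorphic in $D^I$ (holomorphic in each coordinate when the others are fixed), endowed with the supremum norm. A function $F$ on $\mathbb{T}^I$ is identified with the function $(\theta_i)_{i\in I}\mapsto F((e^{i\theta_i})_{i\in I})$ on $\mathbb{R}^I$ (here the $i$ in the exponent is the imaginary unit), which is $2\pi$-periodic in every coordinate, and points of $\mathbb{T}^I$ are correspondingly represented by $\theta\in\mathbb{R}^I$. For $v=(v_i)_{i\in I}\in\mathbb{R}^I$, $\|v\|_\infty=\sup_{i\in I}|v_i|$. A real-valued function $u$ on $\mathbb{T}^I$ is differentiable at $\theta$ in the direction $v$ if the limit $\lim_{t\to0}\frac{u(\theta+tv)-u(\theta)}{t}$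 ($t$ real) exists in $\mathbb{R}$. *)

(* Defs.v *)
From HB Require Import structures.
From mathcomp Require Import all_boot all_order all_algebra.
From mathcomp Require Import all_classical all_reals all_analysis.
From mathcomp Require Import complex borel_hierarchy.

Set Implicit Arguments.
Unset Strict Implicit.
Unset Printing Implicit Defensive.

Import Order.TTheory GRing.Theory Num.Theory.
Import numFieldNormedType.Exports.

Local Open Scope classical_set_scope.
Local Open Scope ring_scope.

(* [R[i]] itself carries no topology; [R[i]^o] is the complex normed line over
   itself, so that [derivable] on [Cplx R] is complex differentiability. *)
Notation Cplx R := (R[i]^o)%type.

Section PolydiscAlgebra.
Context {R : realType} {I : countType}.

Definition open_polydisc : set {ptws I -> Cplx R} :=
  [set z | forall i, `|z i| < 1].

Definition closed_polydisc : set {ptws I -> Cplx R} :=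
  [set z | forall i, `|z i| <= 1].

(* The domain is the subtype [set_type closed_polydisc], whose topology is
   induced by the product topology. [derivable] requires a total function: [f]
   is extended by 0, which is harmless since [z i] is interior to the disc. *)
Definition separately_holomorphic (f : closed_polydisc -> Cplx R) : Prop :=
  forall z, open_polydisc z -> forall i : I,
    derivable (fun w : Cplx R => 'valL_0 f (dfwith z i w)) (z i) 1.

Definition in_polydisc_algebra : {pred closed_polydisc -> Cplx R} :=
  fun f => `[< continuous f /\ separately_holomorphic f >].

End PolydiscAlgebra.

Arguments open_polydisc : clear implicits.
Arguments closed_polydisc : clear implicits.

Record polydisc_algebra (R : realType) (I : countType) := PolydiscAlgebra {
  pda_fun :> closed_polydisc R I -> Cplx R;
  pda_subproof : pda_fun \in in_polydisc_algebra }.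

HB.instance Definition _ (R : realType) (I : countType) :=
  [isSub for @pda_fun R I].
HB.instance Definition _ (R : realType) (I : countType) :=
  [Choice of polydisc_algebra R I by <:].

Section PolydiscAlgebraLmodule.
Context {R : realType} {I : countType}.
Local Notation A := (polydisc_algebra R I).
Local Notation dom := (closed_polydisc R I).
Implicit Types f g : A.

Lemma pda_continuous f : continuous f.
Proof. by have /asboolP[] := pda_subproof f. Qed.

Lemma pda_holomorphic f : separately_holomorphic f.
Proof. by have /asboolP[] := pda_subproof f. Qed.

Lemma valL0D (f g : dom -> Cplx R) z :
  'valL_0 (f + g) z = 'valL_0 f z + 'valL_0 g z.
Proof. by rewrite /valL_ /=; case: ('oinv_set_val z) => //=; rewrite addr0. Qed.

Lemma valL0Z (a : Cplx R) (f : dom -> Cplx R) z :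
  'valL_0 (a *: f) z = a *: 'valL_0 f z.
Proof. by rewrite /valL_ /=; case: ('oinv_set_val z) => //=; rewrite scaler0. Qed.

Lemma pda_scale_subproof (a : Cplx R) (f : dom -> Cplx R) :
  f \in in_polydisc_algebra -> a *: f \in in_polydisc_algebra.
Proof.
move=> /asboolP[cf hf]; apply/asboolP; split.
  by move=> x; exact: (cvgZl_tmp (cf x)).
move=> z zD i; under eq_fun do rewrite valL0Z.
by apply: derivableZ; exact: hf.
Qed.

Lemma pda_zmod_closed : zmod_closed (@in_polydisc_algebra R I).
Proof.
have DP (f g : dom -> Cplx R) : f \in in_polydisc_algebra ->
    g \in in_polydisc_algebra -> f + g \in in_polydisc_algebra.
  move=> /asboolP[cf hf] /asboolP[cg hg]; apply/asboolP; split.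
    by move=> x; exact: (cvgD (cf x) (cg x)).
  move=> z zD i; under eq_fun do rewrite valL0D.
  by apply: derivableD; [exact: hf|exact: hg].
split=> [|f g fA gA].
  apply/asboolP; split; first last.
    move=> z zD i; rewrite [X in derivable X](_ : _ = cst 0).
      exact: derivable_cst.
    by apply/funext => w; rewrite /valL_ /=; case: ('oinv_set_val _).
  by rewrite (_ : 0 = cst (0 : Cplx R))//; exact: cst_continuous.
have -> : f - g = f + ((-1 : Cplx R) *: g : dom -> Cplx R).
  apply/funext => x.
  exact/esym/(congr1 (fun y => f x + y))/(@scaleN1r _ (Cplx R)).
exact: DP fA (pda_scale_subproof _ gA).
Qed.

HB.instance Definition _ :=
  GRing.isZmodClosed.Build _ (@in_polydisc_algebra R I) pda_zmod_closed.
HB.instance Definition _ := [SubChoice_isSubZmodule of A by <:].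

(* Scaling by reals only: [A] is viewed as a real normed space, with the
   real-valued supremum norm. *)
Definition pda_scale (a : R) f : A :=
  PolydiscAlgebra (pda_scale_subproof a%:C%C (pda_subproof f)).

Fact pda_scaleA a b f : pda_scale a (pda_scale b f) = pda_scale (a * b) f.
Proof. by apply: val_inj; rewrite /= scalerA rmorphM. Qed.
Fact pda_scale1 : left_id 1 pda_scale.
Proof. by move=> f; apply: val_inj; rewrite /= scale1r. Qed.
Fact pda_scaleDr : right_distributive pda_scale +%R.
Proof. by move=> a f g; apply: val_inj; rewrite /= scalerDr. Qed.
Fact pda_scaleDl f : {morph pda_scale^~ f : a b / a + b}.
Proof. by move=> a b; apply: val_inj; rewrite /= rmorphD scalerDl. Qed.

HB.instance Definition _ := GRing.Zmodule_isLmodule.Build R A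
  pda_scaleA pda_scale1 pda_scaleDr pda_scaleDl.

Definition supnorm f : R := sup [set Normc.normc (f z) | z in [set: dom]].

Lemma cnormE (w : R[i]) : `|w| = (Normc.normc w)%:C%C.
Proof. by case: w => a b; rewrite normc_def. Qed.

Lemma ler_cnormB (w x : R[i]) :
  `|Normc.normc w - Normc.normc x| <= Normc.normc (w - x).
Proof.
have H (u y : R[i]) : Normc.normc u - Normc.normc y <= Normc.normc (u - y).
  by rewrite lerBlDr -[in leLHS](subrK y u); exact: le_normcD.
rewrite ler_norml H andbT lerNl opprB (le_trans (H _ _))//.
by rewrite -opprB -[leLHS]/(Normc.normc (- (w - x : Rcomplex R))) normcN.
Qed.

Lemma continuous_normc : continuous (@Normc.normc R : Cplx R -> R).
Proof.
move=> w; apply/(@cvgrPdist_lt _ R (Cplx R) _ (nbhs_filter w)) => e e0.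
have eC0 : (0 : R[i]) < e%:C%C by rewrite ltcR.
have := @cvgr_dist_lt _ (Cplx R) _ _ (nbhs_filter w) id w (@cvg_id _ _) _ eC0.
apply: filterS => x /=.
by rewrite cnormE ltcR; apply: le_lt_trans; exact: ler_cnormB.
Qed.

Lemma continuous_complex : continuous (fun p : R * R => (p.1 +i* p.2)%C : Cplx R).
Proof.
move=> p; apply/cvgrPdist_lt => e e0.
have [er er0 ->] : exists2 r : R, 0 < r & e = r%:C%C.
  case: e e0 => a b; rewrite ltcE/= => /andP[/eqP-> a0]; by exists a.
near=> x; rewrite cnormE ltcR.
have -> : (p.1 +i* p.2)%C - (x.1 +i* x.2)%C =
    (p.1 - x.1)%:C%C + (0 +i* (p.2 - x.2))%C :> R[i].
  by apply/eqP; rewrite eq_complex/= !(addr0, add0r) !eqxx.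
rewrite (le_lt_trans (le_normcD _ _))//= !expr0n/= addr0 add0r !sqrtr_sqr.
rewrite (splitr er) ltrD//; near: x.
  by apply: (@cvgr_dist_lt _ R _ _ _ fst); [exact: cvg_fst|rewrite divr_gt0].
by apply: (@cvgr_dist_lt _ R _ _ _ snd); [exact: cvg_snd|rewrite divr_gt0].
Unshelve. all: by end_near. Qed.

Lemma compact_closed_disc : compact [set w : Cplx R | `|w| <= 1].
Proof.
pose S := [set ((p.1 +i* p.2)%C : Cplx R) |
    p in `[-1 : R, 1]%classic `*` `[-1 : R, 1]%classic].
have cS : compact S.
  apply: continuous_compact; last by apply: compact_setX; exact: segment_compact.
  by apply: continuous_subspaceT; exact: continuous_complex.
apply: subclosed_compact cS _.
  rewrite (_ : [set _ | _] = (@Normc.normc R : Cplx R -> R) @^-1` [set x | x <= 1]).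
    by apply: closed_comp; [move=> x _; exact: continuous_normc|exact: closed_le].
  by apply/seteqP; split=> w /=; rewrite cnormE lecR.
move=> [a b] /=; rewrite cnormE lecR/= => ab; exists (a, b) => //=.
have ab1 : a ^+ 2 + b ^+ 2 <= 1.
  by rewrite -[leLHS]sqr_sqrtr ?addr_ge0 ?sqr_ge0// expr_le1 ?sqrtr_ge0.
split; rewrite /= in_itv/= -ler_norml -sqrtr_sqr.
  by rewrite (le_trans _ ab)// ler_wsqrtr// lerDl sqr_ge0.
by rewrite (le_trans _ ab)// ler_wsqrtr// lerDr sqr_ge0.
Qed.

Lemma pda_bounded f : has_ubound [set Normc.normc (f z) | z in [set: dom]].
Proof.
have cD : compact dom := @tychonoff I (fun=> Cplx R) _ (fun=> compact_closed_disc).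
have cf : {within dom, continuous ('valL_0 f)}.
  by apply/subspace_valL_continuousP'; exact: pda_continuous.
have cn : {within dom, continuous (@Normc.normc R \o 'valL_0 f : _ -> R)}.
  move=> z; apply: continuous_comp; [exact: cf|exact: continuous_normc].
have /compact_bounded[M [_ /(_ (M + 1))]] := continuous_compact cn cD.
rewrite ltrDl => /(_ ltr01) bM; exists (M + 1) => _ [z _ <-].
rewrite (le_trans (ler_norm _))//; apply: bM; exists (set_val z).
  exact: set_valP.
by rewrite /= -[RHS](congr1 (fun g : dom -> Cplx R => Normc.normc (g z)) (valLK 0 f)).
Qed.

Lemma closed_polydisc0_subproof : (fun=> 0 : Cplx R) \in dom.
Proof. by rewrite inE => i; rewrite normr0. Qed.

Definition closed_polydisc0 : dom := SigSub closed_polydisc0_subproof.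

Lemma supnorm_ge f z : Normc.normc (f z) <= supnorm f.
Proof. by apply: ub_le_sup; [exact: pda_bounded|exists z]. Qed.

Lemma supnorm_le f c : (forall z, Normc.normc (f z) <= c) -> supnorm f <= c.
Proof.
move=> H; apply: ge_sup; last by move=> _ [z _ <-].
by exists (Normc.normc (f closed_polydisc0)), closed_polydisc0.
Qed.

Fact supnormD f g : supnorm (f + g) <= supnorm f + supnorm g.
Proof.
apply: supnorm_le => z; rewrite (le_trans (le_normcD (f z) (g z)))//.
by rewrite lerD// supnorm_ge.
Qed.

Fact supnormZ a f : supnorm (a *: f) = `|a| * supnorm f.
Proof.
have sZ z : Normc.normc ((a *: f) z) = `|a| * Normc.normc (f z).
  by rewrite [LHS]Normc.normcM/= expr0n/= addr0 sqrtr_sqr.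
apply/eqP; rewrite eq_le; apply/andP; split.
  by apply: supnorm_le => z; rewrite sZ ler_wpM2l// supnorm_ge.
have [->|a0] := eqVneq a 0.
  rewrite normr0 mul0r (le_trans _ (supnorm_ge _ closed_polydisc0))//.
  by case: (pda_fun _ _) => *; exact: sqrtr_ge0.
rewrite mulrC -ler_pdivlMr ?normr_gt0//; apply: supnorm_le => z.
by rewrite ler_pdivlMr ?normr_gt0// mulrC -sZ supnorm_ge.
Qed.

Fact supnorm0_eq0 f : supnorm f = 0 -> f = 0.
Proof.
move=> f0; apply: val_inj; apply/funext => z /=.
apply: Normc.eq0_normc; apply/eqP; rewrite eq_le -{1}f0 supnorm_ge/=.
by case: (f z) => a b /=; exact: sqrtr_ge0.
Qed.

HB.instance Definition _ :=
  Lmodule_isNormed.Build R A supnormD supnormZ supnorm0_eq0.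

Lemma pda_normE f : `|f| = supnorm f. Proof. by []. Qed.

End PolydiscAlgebraLmodule.

Section DirectionalDifferentiability.
Context {R : realType} {I : countType}.

Lemma torus_closed_polydisc (theta : I -> R) :
  (fun i => (cos (theta i) +i* sin (theta i))%C : Cplx R) \in
    closed_polydisc R I.
Proof. by rewrite inE => i; rewrite normc_def/= cos2Dsin2 sqrtr1. Qed.

(* the point $(e^{i\theta_j})_{j \in I}$ of the torus *)
Definition torus_point (theta : I -> R) : closed_polydisc R I :=
  SigSub (torus_closed_polydisc theta).

Definition linfty_norm (v : I -> R) : \bar R :=
  ereal_sup [set `|v i|%:E | i in [set: I]].

Definition differentiable_along (u : (I -> R) -> R) (theta v : I -> R) : Prop :=
  cvg ((u (fun i => theta i + t * v i) - u theta) / t @[t --> 0^']).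

Definition boundary_Re (f : polydisc_algebra R I) (theta : I -> R) : R :=
  complex.Re (f (torus_point theta)).

Definition boundary_Im (f : polydisc_algebra R I) (theta : I -> R) : R :=
  complex.Im (f (torus_point theta)).

Definition nowhere_directionally_differentiable (f : polydisc_algebra R I) :
    Prop :=
  forall theta v : I -> R, linfty_norm v = 1%E ->
    ~ differentiable_along (boundary_Re f) theta v /\
    ~ differentiable_along (boundary_Im f) theta v.

End DirectionalDifferentiability.

Definition residual (T : topologicalType) (S : set T) : Prop :=
  exists G : set T, [/\ Gdelta G, dense G & G `<=` S].

(* Main.v *)
Require Import Defs.
From mathcomp Require Import all_boot all_order all_algebra.
From mathcomp Require Import all_classical all_reals all_analysis.
From mathcomp Require Import complex.
From mathcomp Require Import ring lra.

(** The dense G_delta is the intersection of countably many explicit open sets,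
    and adding a lacunary series to an arbitrary function produces an element of
    all of them nearby.

    For a natural number [n] and a coordinate [j], call [f] steep if there is
    [d > 0] such that for every point [th] of the torus and every direction [v]
    with [|v_i| <= 1] for all [i] and [|v_j| >= 1/2], each of the real and
    imaginary parts of [f] changes by at least [n |t| + d] between [th] and
    [th + t v] for some [t]. The margin [d] makes this condition open
    ([open_steep]). A direction of supremum norm 1 has a coordinate of modulus
    at least 1/2, even if the supremum is not attained; and since [f] is
    bounded, a change larger than [n |t|] with [n] large forces [t] to be small.
    Hence a function that is steep for all [n] and [j] has difference quotients
    that are unbounded near 0, at all points and in all directions
    ([steep_not_differentiable]).

    For density ([steep_dense]), a given [g] is perturbed to
    [f = g + \sum_k e_k z_(j_k) ^ N_k] with [e_k = c / (8 * 32 ^ k)], where the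
    index [k] codes a pair [(j_k, n_k)] and [N_k] grows fast. If
    [|v_(j_k)| >= 1/2], moving along [v] by a suitable [t] of order [1 / N_k]
    turns the [k]-th monomial by a quarter of a circle, which in one of the two
    senses of rotation changes the real part of the [k]-th term by at least
    [e_k], and similarly for the imaginary part ([cos_swing]). At this scale
    nothing else moves much: the later terms are too small, the earlier terms
    are Lipschitz with a constant negligible against [N_k], and [g] is uniformly
    continuous on the torus, by compactness ([torus_uniform_continuity]). Since
    [n_k |t|] is small against [e_k] as well, [f] is steep for [(n_k, j_k)].

    The sum of the series lies in the algebra ([lacunary_polydisc_algebra]): it
    is a uniform limit of polynomials, and its complex derivatives exist because
    the difference quotients of [w ^ N] are bounded on each smaller disc
    independently of [N]. *)

Set Implicit Arguments.
Unset Strict Implicit.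
Unset Printing Implicit Defensive.

Import Order.TTheory GRing.Theory Num.Theory.
Import numFieldNormedType.Exports.

Local Open Scope classical_set_scope.
Local Open Scope ring_scope.

Local Notation normc := Normc.normc.

(** * Modulus of complex numbers *)

Section ComplexModulus.
Context {R : realType}.
Implicit Types w x : R[i].

Lemma normc_ge0 w : 0 <= normc w.
Proof. by case: w => a b; exact: sqrtr_ge0. Qed.

Lemma normcBC w x : normc (w - x) = normc (x - w).
Proof. by rewrite -opprB -[LHS]/(normc (- (x - w : Rcomplex R))) normcN. Qed.

Lemma normc_triangle w y x : normc (w - x) <= normc (w - y) + normc (y - x).
Proof. by rewrite -(subrKA y); exact: le_normcD. Qed.

Lemma normcB_le w x : normc (w - x) <= normc w + normc x.
Proof. by have := normc_triangle w 0 x; rewrite subr0 (normcBC 0) subr0. Qed.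

Lemma normc_real (r : R) : normc r%:C%C = `|r|.
Proof. by rewrite /= expr0n/= addr0 sqrtr_sqr. Qed.

Lemma normc0 : normc (0 : R[i]) = 0.
Proof. by rewrite (normc_real 0) normr0. Qed.

Lemma normc_leReIm w : normc w <= `|complex.Re w| + `|complex.Im w|.
Proof.
case: w => a b /=; rewrite -[leRHS]ger0_norm ?addr_ge0// -sqrtr_sqr ler_wsqrtr//.
rewrite sqrrD !real_normK ?num_real// lerD2r lerDl.
by rewrite mulrn_wge0// mulr_ge0.
Qed.

Lemma normc_geRe w : `|complex.Re w| <= normc w.
Proof. by case: w => a b /=; rewrite -sqrtr_sqr ler_wsqrtr// lerDl sqr_ge0. Qed.

Lemma normc_geIm w : `|complex.Im w| <= normc w.
Proof. by case: w => a b /=; rewrite -sqrtr_sqr ler_wsqrtr// lerDr sqr_ge0. Qed.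

Lemma normcX w n : normc (w ^+ n) = normc w ^+ n.
Proof.
elim: n => [|n IH]; first by rewrite !expr0 (normc_real 1) normr1.
by rewrite !exprS Normc.normcM IH.
Qed.

Lemma normcV w : normc (w^-1) = (normc w)^-1.
Proof.
have [->|w0] := eqVneq w 0; first by rewrite invr0 normc0 invr0.
have nw0 : normc w != 0 by apply: contra_neq w0; exact: Normc.eq0_normc.
by apply: (mulfI nw0); rewrite -Normc.normcM !divff// (normc_real 1) normr1.
Qed.

(** The norm of [Cplx R] takes values in [R[i]]; this criterion and the next one
    use the real-valued modulus instead, so that estimates can be carried out in
    the ordered field [R]. *)
Lemma cvg_normcP {T : Type} (F : set_system T) {FF : Filter F}
    (f : T -> Cplx R) (l : Cplx R) :
  f @ F --> l <-> forall e, 0 < e -> \forall y \near F, normc (f y - l) < e.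
Proof.
split=> [fl e e0|fl].
  have eC0 : (0 : R[i]) < e%:C%C by rewrite ltcR.
  apply: filterS (@cvgr_distC_lt _ (Cplx R) _ F FF f l fl _ eC0) => y.
  by rewrite cnormE ltcR.
apply/cvgrPdistC_lt => e e0.
have [r r0 ->] : exists2 r : R, 0 < r & e = r%:C%C.
  case: e e0 => a b; rewrite ltcE/= => /andP[/eqP-> a0]; by exists a.
by apply: filterS (fl r r0) => y; rewrite cnormE ltcR.
Qed.

Lemma derivable_normcP (f : Cplx R -> Cplx R) (z : Cplx R) :
  derivable f z 1 <-> exists l : R[i], forall e, 0 < e -> exists2 d, 0 < d &
    forall h, 0 < normc h < d ->
      normc (h^-1 * (f (z + h) - f z) - l) < e.
Proof.
rewrite /derivable; split=> [/cvg_ex[l /= /cvg_normcP fl]|[l fl]].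
  exists l => e /fl; rewrite near_withinE => /nbhs_normP[d /= d0 dH].
  case: d d0 dH => a b; rewrite ltcE/= => /andP[/eqP-> a0] dH; exists a => //.
  move=> h /andP[h0 ha]; have := dH h.
  rewrite /ball_/= sub0r normrN cnormE ltcR => /(_ ha) /=.
  have -> : (h *: (1 : Cplx R)) = h by exact: mulr1.
  rewrite (addrC h) => H; apply: H; apply: contraTneq h0 => ->.
  by rewrite normc0 ltxx.
apply/cvg_ex; exists (l : Cplx R); apply/cvg_normcP => e /fl[d d0 dH].
rewrite near_withinE; apply/nbhs_normP; exists (d%:C%C : R[i]).
  by rewrite /= ltcR.
move=> h; rewrite /ball_/= sub0r normrN cnormE ltcR => hd h0.
have -> : (h *: (1 : Cplx R)) = h by exact: mulr1.
rewrite /= (addrC h); apply: dH; rewrite hd andbT lt_neqAle normc_ge0 andbT eq_sym.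
by apply: contra_neq h0; exact: Normc.eq0_normc.
Qed.

End ComplexModulus.

(** * Series dominated by a sequence that at least halves at each step *)

Section HalvingSeries.
Context {R : realType}.
Variable e : nat -> R.
Hypothesis e_ge0 : forall k, 0 <= e k.
Hypothesis e_half : forall k, e k.+1 <= e k / 2.

Lemma halving_small (c : R) n : 0 < c -> exists2 m, (n <= m)%N & e m < c.
Proof.
move=> c0.
have eb k : e k <= e 0%N / (k.+1)%:R.
  elim: k => [|k IH]; first by rewrite divr1.
  apply: le_trans (e_half k) _; apply: le_trans (_ : e 0%N / k.+1%:R / 2 <= _).
    by rewrite ler_wpM2r// invr_ge0.
  rewrite -mulrA ler_wpM2l// -invfM lef_pV2 ?posrE ?mulr_gt0 ?ltr0n//.
  by rewrite -natrM ler_nat muln2 -addnn addSn ltnS leq_addl.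
pose m := maxn n (Num.truncn (e 0%N / c)).
exists m; first exact: leq_maxl.
apply: le_lt_trans (eb m) _; rewrite ltr_pdivrMr ?ltr0n// mulrC -ltr_pdivrMr//.
rewrite (lt_le_trans (truncnS_gt _))// ler_nat ltnS; exact: leq_maxr.
Qed.

Lemma le_of_halving (x y K : R) n :
  0 <= K -> (forall m, (n <= m)%N -> x <= y + K * e m) -> x <= y.
Proof.
move=> K0 H; apply/ler_addgt0Pr => c c0.
have K1 : 0 < K + 1 by rewrite ltr_wpDl.
have [m nm em] := halving_small n (divr_gt0 c0 K1).
rewrite (le_trans (H m nm))// lerD2l.
move: em; rewrite ltr_pdivlMr// => /ltW; apply: le_trans.
by rewrite mulrC ler_wpM2l// lerDl.
Qed.

(** The bound [2 * e n - 2 * e m] on the block of terms from [n] to [m] is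
    preserved when [m] grows, because [e m.+1 <= e m / 2]. *)
Lemma halving_tail (a : nat -> R[i]) n m : (forall k, normc (a k) <= e k) ->
  (n <= m)%N -> normc (\sum_(k < m) a k - \sum_(k < n) a k) <= 2 * e n.
Proof.
move=> ae /subnKC <-; set d := (m - n)%N.
suff: normc (\sum_(k < n + d) a k - \sum_(k < n) a k) <= 2 * e n - 2 * e (n + d)%N.
  by move=> H; apply: le_trans H _; rewrite gerBl mulr_ge0.
elim: d => [|d IH]; first by rewrite addn0 !subrr normc0.
rewrite addnS big_ord_recr/= addrAC.
apply: le_trans (le_normcD _ _) _.
apply: le_trans (lerD IH (ae _)) _; have := e_half (n + d); lra.
Qed.

(** By the halving, the intervals of centre [S n] and radius [2 * e n] are
    nested; the sum is the supremum of their left ends. *)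
Lemma real_halving_sum (x : nat -> R) : (forall k, `|x k| <= e k) ->
  exists s, forall n, `|s - \sum_(k < n) x k| <= 2 * e n.
Proof.
move=> xe; pose S n := \sum_(k < n) x k.
have lo n m : (n <= m)%N -> S n - 2 * e n <= S m - 2 * e m.
  move=> /subnKC <-; elim: (m - n)%N => [|d]; first by rewrite addn0.
  move/le_trans; apply; rewrite addnS /S big_ord_recr/=.
  have := xe (n + d)%N; rewrite ler_norml => /andP[]; have := e_half (n + d); lra.
have hi n m : (n <= m)%N -> S m + 2 * e m <= S n + 2 * e n.
  move=> /subnKC <-; elim: (m - n)%N => [|d]; first by rewrite addn0.
  apply: le_trans; rewrite addnS /S big_ord_recr/=.
  have := xe (n + d)%N; rewrite ler_norml => /andP[]; have := e_half (n + d); lra.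
have lohi n m : S n - 2 * e n <= S m + 2 * e m.
  have := lo n (maxn n m) (leq_maxl _ _); have := hi m (maxn n m) (leq_maxr _ _).
  have := e_ge0 (maxn n m); lra.
exists (sup [set S n - 2 * e n | n in setT]) => n.
rewrite -/(S n) ler_norml.
have lb : S n - 2 * e n <= sup [set S n - 2 * e n | n in setT].
  apply: ub_le_sup; last by exists n.
  by exists (S 0%N + 2 * e 0%N) => _ [m _ <-].
have ub : sup [set S n - 2 * e n | n in setT] <= S n + 2 * e n.
  apply: ge_sup; first by exists (S n - 2 * e n), n.
  by move=> _ [m _ <-].
by move: lb ub; lra.
Qed.

Lemma complex_halving_sum (a : nat -> R[i]) : (forall k, normc (a k) <= e k) ->
  exists s, forall n, normc (s - \sum_(k < n) a k) <= 4 * e n.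
Proof.
move=> ae.
have [|x Hx] := @real_halving_sum (fun k => complex.Re (a k)).
  by move=> k; exact: le_trans (normc_geRe _) (ae k).
have [|y Hy] := @real_halving_sum (fun k => complex.Im (a k)).
  by move=> k; exact: le_trans (normc_geIm _) (ae k).
exists (x +i* y)%C => n; apply: le_trans (normc_leReIm _) _.
rewrite !raddfB !raddf_sum/= !sumrN; have := Hx n; have := Hy n; lra.
Qed.


Lemma continuous_halving_sum (T : topologicalType) (p : nat -> T -> Cplx R)
    (S : T -> Cplx R) :
  (forall k, continuous (p k)) ->
  (forall n x, normc (S x - \sum_(k < n) p k x) <= 4 * e n) -> continuous S.
Proof.
move=> cp Sp x; apply/cvg_normcP => c c0.
have [n _ en] := halving_small 0 (divr_gt0 c0 (ltr0Sn _ 15)).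
have csum : (fun y => \sum_(k < n) p k y : Cplx R) @ x -->
    (\sum_(k < n) p k x : Cplx R).
  elim: n {en} => [|n IH].
    by under eq_fun do rewrite big_ord0; rewrite big_ord0; exact: cvg_cst.
  under eq_fun do rewrite big_ord_recr/=.
  by rewrite big_ord_recr/=; apply: cvgD IH _; exact: cp.
have c2 : 0 < c / 2 by rewrite divr_gt0.
have /cvg_normcP/(_ _ c2) := csum; apply: filterS => y xy.
apply: le_lt_trans (normc_triangle _ (\sum_(k < n) p k y) _) _.
have := normc_triangle (\sum_(k < n) p k y) (\sum_(k < n) p k x) (S x).
rewrite (normcBC (\sum_(k < n) p k x) (S x)).
have := Sp n x; have := Sp n y; lra.
Qed.

End HalvingSeries.

Section TermwiseDerivability.
Context {R : realType}.
Variable e : nat -> R.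
Hypothesis e_ge0 : forall k, 0 <= e k.
Hypothesis e_half : forall k, e k.+1 <= e k / 2.

(** Termwise differentiation: the difference quotients at [z] are dominated by
    [B * e k] uniformly in the increment [h], hence so are the derivatives of
    the terms, and the limit [h --> 0] may be taken term by term. *)
Lemma derivable_halving_sum (p : nat -> Cplx R -> Cplx R)
    (S : Cplx R -> Cplx R) (z : Cplx R) (d B : R) :
  0 < d -> 0 <= B -> (forall k, derivable (p k) z 1) ->
  (forall k h, normc h < d -> normc (p k (z + h) - p k z) <= B * e k * normc h) ->
  (forall n w, normc (w - z) < d -> normc (S w - \sum_(k < n) p k w) <= 4 * e n) ->
  derivable S z 1.
Proof.
move=> d0 B0 dp pB SpE.
have /choice[D HD] : forall k, exists l : R[i], forall c, 0 < c ->
    exists2 d, 0 < d & forall h, 0 < normc h < d ->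
      normc (h^-1 * (p k (z + h) - p k z) - l) < c.
  by move=> k; have /derivable_normcP := dp k.
pose q k h := h^-1 * (p k (z + h) - p k z).
have qB k h : 0 < normc h < d -> normc (q k h) <= B * e k.
  move=> /andP[h0 hd]; rewrite /q Normc.normcM normcV mulrC ler_pdivrMr//.
  exact: pB.
have DB k : normc (D k) <= B * e k.
  apply/ler_addgt0Pr => c c0; have [r r0 Hr] := HD k c c0.
  pose m := Num.min r d / 2.
  have m0 : 0 < Num.min r d by rewrite lt_min r0.
  have nm : normc (m%:C%C : R[i]) = m by rewrite normc_real ger0_norm// divr_ge0// ltW.
  have mr : m < r.
    rewrite ltr_pdivrMr// (@le_lt_trans _ _ r)// ?ge_min ?lexx//.
    by rewrite mulr_natr mulr2n ltrDl.
  have md : m < d.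
    rewrite ltr_pdivrMr// (@le_lt_trans _ _ d)// ?ge_min ?lexx ?orbT//.
    by rewrite mulr_natr mulr2n ltrDl.
  have mp : 0 < m by rewrite divr_gt0.
  have := Hr m%:C%C; rewrite nm mp mr => /(_ isT); rewrite -/(q _ _) normcBC => H1.
  have := qB k m%:C%C; rewrite nm mp md => /(_ isT) H2.
  rewrite -(subrK (q k m%:C%C) (D k)) (le_trans (le_normcD _ _))//.
  by rewrite addrC lerD// ltW.
have Be_ge0 k : 0 <= B * e k by rewrite mulr_ge0.
have Be_half k : B * e k.+1 <= B * e k / 2 by rewrite -mulrA ler_wpM2l.
have [l Hl] := complex_halving_sum Be_ge0 Be_half DB.
have Hfin n c : 0 < c -> exists2 r, 0 < r & forall h, 0 < normc h < r ->
    normc (\sum_(k < n) q k h - \sum_(k < n) D k) < c.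
  elim: n c => [|n IH] c c0.
    by exists 1 => // h _; rewrite !big_ord0 subrr normc0.
  have c2 : 0 < c / 2 by rewrite divr_gt0.
  have [r1 r10 H1] := IH _ c2; have [r2 r20 H2] := HD n _ c2.
  exists (Num.min r1 r2); first by rewrite lt_min r10.
  move=> h /andP[h0]; rewrite lt_min => /andP[hr1 hr2].
  rewrite !big_ord_recr/= opprD addrACA (le_lt_trans (le_normcD _ _))//.
  by rewrite (splitr c) ltrD// ?H1 ?H2 ?h0.
apply/derivable_normcP; exists l => c c0.
have K0 : 0 < 12 * (B + 1) by rewrite mulr_gt0// ltr_wpDl.
have [n _ en] := halving_small e_ge0 e_half 0 (divr_gt0 c0 K0).
have c2 : 0 < c / 2 by rewrite divr_gt0.
have [r r0 Hr] := Hfin n _ c2.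
exists (Num.min r d); first by rewrite lt_min r0.
move=> h /andP[h0]; rewrite lt_min => /andP[hr hd].
(* The [m]-th remainder of [S] has modulus at most [4 * e m] at both points;
   divided by [h] this is still negligible as [m] grows, for fixed [h]. *)
have tail : normc (h^-1 * (S (z + h) - S z) - \sum_(k < n) q k h) <= 2 * (B * e n).
  apply: (@le_of_halving _ e e_ge0 e_half _ _ (8 * (normc h)^-1) n).
    by rewrite mulr_ge0// invr_ge0 ltW.
  move=> m nm.
  have -> : h^-1 * (S (z + h) - S z) - \sum_(k < n) q k h =
    (\sum_(k < m) q k h - \sum_(k < n) q k h) +
    (h^-1 * (S (z + h) - \sum_(k < m) p k (z + h)) -
     h^-1 * (S z - \sum_(k < m) p k z)).
    have -> : \sum_(k < m) q k h =
        h^-1 * (\sum_(k < m) p k (z + h) - \sum_(k < m) p k z).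
      rewrite mulrBr !mulr_sumr -sumrB.
      by apply: eq_bigr => k _; rewrite /q mulrBr.
    ring.
  rewrite (le_trans (le_normcD _ _))// lerD//.
    apply: (@halving_tail _ (fun k => B * e k) Be_ge0 Be_half (q^~ h)) => // k.
    by apply: qB; rewrite h0.
  rewrite -mulrBr Normc.normcM normcV mulrAC mulrC ler_wpM2r ?invr_ge0 ?normc_ge0//.
  have zh : normc (z + h - z) < d by rewrite addrC addKr.
  have zz : normc (z - z) < d by rewrite subrr normc0.
  have := normcB_le (S (z + h) - \sum_(k < m) p k (z + h)) (S z - \sum_(k < m) p k z).
  have := SpE m _ zh; have := SpE m _ zz; lra.
apply: le_lt_trans (normc_triangle _ (\sum_(k < n) q k h) _) _.
have := normc_triangle (\sum_(k < n) q k h) (\sum_(k < n) D k) l.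
rewrite (normcBC (\sum_(k < n) D k) l); have := Hl n.
have := Hr h; rewrite h0 hr => /(_ isT).
move: en; rewrite ltr_pdivlMr//.
have := e_ge0 n; have := Be_ge0 n; lra.
Qed.

End TermwiseDerivability.

(** * Oscillation of the exponential on the unit circle *)

Section Trigonometry.
Context {R : realType}.
Implicit Types a b : R.

Definition expi a : R[i] := (cos a +i* sin a)%C.

Lemma expiX a n : expi a ^+ n = expi (n%:R * a).
Proof.
elim: n => [|n IH]; first by rewrite expr0 mul0r /expi cos0 sin0.
rewrite exprS IH -[n.+1]addn1 natrD mulrDl mul1r addrC /expi cosD sinD.
by apply/eqP; rewrite eq_complex /= eqxx/= addrC.
Qed.

Lemma cos_lipschitz a b : `|cos a - cos b| <= `|a - b|.
Proof.
wlog ab : a b / a <= b.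
  have [ab|/ltW ba] := leP a b; first exact.
  by move=> /(_ b a ba); rewrite distrC (distrC a).
rewrite distrC (distrC a).
have [|c _ ->] := @MVT_segment R cos (fun x => - sin x) a b ab _.
  by apply: continuous_subspaceT; exact: continuous_cos.
by rewrite normrM normrN ler_piMl// ler_norml sin_geN1 sin_le1.
Qed.

Lemma sin_cosBpihalf a : sin a = cos (a - pi / 2).
Proof. by rewrite cosB cos_pihalf sin_pihalf mulr0 add0r mulr1. Qed.

Lemma expi_lipschitz a b : normc (expi a - expi b) <= 2 * `|a - b|.
Proof.
apply: le_trans (normc_leReIm _) _; rewrite /= !sin_cosBpihalf.
have := cos_lipschitz a b.
have := cos_lipschitz (a - pi / 2) (b - pi / 2).
have -> : a - pi / 2 - (b - pi / 2) = a - b by ring.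
lra.
Qed.

(** A quarter turn replaces [cos a] by [- s * sin a], and
    [(s * sin a + cos a) ^ 2 = 1 + 2 * s * sin a * cos a], so that the sign [s]
    of [sin a * cos a] is a good sense of rotation. *)
Lemma cos_swing a :
  exists2 s : R, `|s| = 1 & 1 <= `|cos (a + s * (pi / 2)) - cos a|.
Proof.
have sw (s : R) : `|s| = 1 -> 0 <= s * (sin a * cos a) ->
    1 <= `|cos (a + s * (pi / 2)) - cos a|.
  move=> s1 s0.
  have -> : cos (a + s * (pi / 2)) = - s * sin a.
    have /eqP := s1; rewrite eqr_norml ler01 andbT => /orP[]/eqP->.
      by rewrite mul1r cosD cos_pihalf sin_pihalf; ring.
    by rewrite mulN1r cosB cos_pihalf sin_pihalf; ring.
  rewrite -(@ler_pXn2r _ 2)// ?nnegrE// expr1n real_normK ?num_real//.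
  have s2 : s ^+ 2 = 1 by rewrite -real_normK ?num_real// s1 expr1n.
  have := cos2Dsin2 a; nra.
have [sc|/ltW sc] := leP 0 (sin a * cos a).
  by exists 1; rewrite ?normr1// sw ?normr1// mul1r.
by exists (-1); rewrite ?normrN1// sw ?normrN1// mulN1r oppr_ge0.
Qed.

End Trigonometry.

(** * Uniform continuity on the torus *)

Section UniformContinuity.
Context {R : realType} {I : countType}.
Local Notation P := {ptws I -> Cplx R}.

(** The product topology is coarser than that of uniform convergence, locally
    uniformly in the centre. The sets [W] that satisfy the conclusion form a
    filter, which converges to [z] because it does so in each coordinate. *)
Lemma ptws_nbhs_uniform (z : P) (W : set P) : nbhs z W ->
  exists2 V : set P, nbhs z V & exists2 r : R, 0 < r &
    forall z' z'' : P, V z' -> (forall i, normc (z'' i - z' i) <= r) -> W z''.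
Proof.
pose G : set_system P := [set A | exists2 V : set P, nbhs z V &
  exists2 r : R, 0 < r &
    forall z' z'' : P, V z' -> (forall i, normc (z'' i - z' i) <= r) -> A z''].
have FG : Filter G.
  split.
  - by exists setT; [exact: filterT|exists 1].
  - move=> A B [V zV [r r0 HV]] [V' zV' [r' r'0 HV']].
    exists (V `&` V'); first exact: filterI.
    exists (Num.min r r'); first by rewrite lt_min r0.
    move=> z' z'' [Vz' V'z'] H; split; [apply: HV Vz' _|apply: HV' V'z' _] => i.
      by rewrite (le_trans (H i))// ge_min lexx.
    by rewrite (le_trans (H i))// ge_min lexx orbT.
  - move=> A B AB [V zV [r r0 HV]]; exists V => //; exists r => // z' z'' Vz' H.
    exact/AB/(HV z').
suff : G --> z by move/(_ W).
have surj i : range (fun z : P => z i) = setT.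
  rewrite eqEsubset; split=> // y _; exists (dfwith z i y) => //.
apply/cvg_sup => i; apply/cvg_image; first exact: surj.
move=> V Vz; exists (proj i @^-1` V); last by rewrite image_preimage// surj.
have [e e0 eV] : exists2 e : R, 0 < e & forall w : Cplx R, normc (w - z i) < e -> V w.
  have /nbhs_normP[d /= d0 dH] := Vz.
  case: d d0 dH => a b; rewrite ltcE/= => /andP[/eqP-> a0] dH; exists a => //.
  by move=> w wa; apply: dH; rewrite /ball_/= cnormE ltcR normcBC.
have e2 : 0 < e / 2 by rewrite divr_gt0.
have pz := @proj_continuous I (fun=> Cplx R) i z.
have zi := (@cvg_normcP R P (nbhs z) (@nbhs_filter P z) (fun z' => z' i) (z i)).1 pz _ e2.
exists [set z' : P | normc (z' i - z i) < e / 2] => //.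
exists (e / 2) => // z' z'' z'i /(_ i) H; apply: eV.
apply: le_lt_trans (normc_triangle _ (z' i) _) _.
by rewrite (splitr e) ler_ltD.
Qed.

(** Although the closed polydisc only carries the product topology, continuous
    functions are uniformly continuous for the supremum distance of the angles,
    with a modulus that holds for all coordinates at once: by compactness of the
    polydisc it suffices to work near one point. *)
Lemma torus_uniform_continuity (f : closed_polydisc R I -> Cplx R) (c : R) :
  continuous f -> 0 < c -> exists2 r, 0 < r &
    forall th th' : I -> R, (forall i, `|th' i - th i| <= r) ->
      normc (f (torus_point th') - f (torus_point th)) < c.
Proof.
move=> cf c0.
have cD : compact (closed_polydisc R I) :=
  @tychonoff I (fun=> Cplx R) _ (fun=> @compact_closed_disc R).
pose Q (r : R) (z : P) := forall th th' : I -> R, set_val (torus_point th) = z ->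
  (forall i, `|th' i - th i| <= r) ->
  normc (f (torus_point th') - f (torus_point th)) < c.
have : \forall r \near (0 : R)^'+, closed_polydisc R I `<=` Q r.
  move/compact_near_coveringP : cD; apply=> z zD.
  pose x : closed_polydisc R I := SigSub (mem_set zD).
  have c2 : 0 < c / 2 by rewrite divr_gt0.
  have xn : nbhs x [set y | normc (f y - f x) < c / 2] :=
    (@cvg_normcP _ _ _ (nbhs_filter x) f (f x)).1 (cf x) _ c2.
  move: xn; rewrite nbhsE/= => -[_ [[W oW <-] Wx] WH].
  have zW : nbhs z W by apply: open_nbhs_nbhs; split.
  have [V zV [r r0 HV]] := ptws_nbhs_uniform zW.
  have r2 : 0 < r / 2 by rewrite divr_gt0.
  exists (V, [set s : R | s <= r / 2]).
    by split => //=; exact: nbhs_right_le.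
  move=> [z' s] /= [Vz' sr] th th' thz' thth'.
  have close (t t' : I -> R) : (forall i, `|t' i - t i| <= r / 2) -> forall i,
      normc (set_val (torus_point t') i - set_val (torus_point t) i) <= r.
    move=> tt' i; apply: le_trans (expi_lipschitz _ _) _.
    by rewrite mulrC -ler_pdivlMr.
  have W1 (t : I -> R) : (forall i, `|t i - th i| <= r / 2) ->
      normc (f (torus_point t) - f x) < c / 2.
    move=> tth; apply: WH; apply: (HV z') => //=; rewrite -thz'.
    exact: close.
  rewrite (le_lt_trans (normc_triangle _ (f x) _))// (splitr c) ltrD//.
    by apply: W1 => i; apply: le_trans sr.
  by rewrite normcBC; apply: W1 => i; rewrite subrr normr0 ltW.
case=> r /= r0 Hr; exists (r / 2); first by rewrite divr_gt0.
move=> th th' H; apply: (Hr (r / 2)) => //=.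
- rewrite sub0r normrN gtr0_norm ?divr_gt0//.
  by rewrite ltr_pdivrMr// mulr_natr mulr2n ltrDl.
- by rewrite divr_gt0.
- exact: set_valP.
Qed.

End UniformContinuity.

(** * Lacunary series in the polydisc algebra *)

Section Lacunary.
Context {R : realType} {I : countType}.

(** The geometric sum [w ^ (n-1) + w ^ (n-2) x + ... + x ^ (n-1)] has modulus at
    most [n * r ^ (n-1) <= 1 + r + ... + r ^ (n-1) <= (1 - r)^-1]; the point is
    that this does not depend on [n]. *)
Lemma normc_subX_le (r : R) (w x : R[i]) n : normc w <= r -> normc x <= r -> r < 1 ->
  normc (w ^+ n - x ^+ n) <= (1 - r)^-1 * normc (w - x).
Proof.
move=> wr xr r1; have r0 : 0 <= r by rewrite (le_trans (normc_ge0 w)).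
rewrite mulrC ler_pdivlMr ?subr_gt0//.
suff H : normc (w ^+ n - x ^+ n) * (1 - r) <= normc (w - x) * (1 - r ^+ n).
  by rewrite (le_trans H)// ler_piMr ?normc_ge0// gerBl exprn_ge0.
elim: n => [|n IH]; first by rewrite !expr0 !subrr normc0 mul0r mulr0.
have -> : w ^+ n.+1 - x ^+ n.+1 = w * (w ^+ n - x ^+ n) + (w - x) * x ^+ n.
  by rewrite !exprS; ring.
have r'0 : 0 <= 1 - r by rewrite subr_ge0 ltW.
apply: le_trans (ler_wpM2r r'0 (le_normcD _ _)) _.
rewrite !Normc.normcM normcX mulrDl -mulrA.
have H1 : normc w * (normc (w ^+ n - x ^+ n) * (1 - r)) <=
    r * (normc (w - x) * (1 - r ^+ n)).
  by apply: ler_pM; rewrite ?normc_ge0 ?mulr_ge0 ?normc_ge0.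
have H2 : normc (w - x) * normc x ^+ n * (1 - r) <= normc (w - x) * r ^+ n * (1 - r).
  by rewrite ler_wpM2r// ler_wpM2l ?normc_ge0// lerXn2r ?nnegrE ?normc_ge0.
apply: le_trans (lerD H1 H2) _.
rewrite mulrCA -mulrA -mulrDr ler_wpM2l ?normc_ge0// exprS.
have : 0 <= (1 - r) * (1 - r ^+ n) by rewrite mulr_ge0// subr_ge0 exprn_ile1// ltW.
by move=> H; lra.
Qed.

(** The case [None] accounts for the indices of the series that do not code any
    coordinate. *)
Definition monomial (j : option I) (N : nat) (z : I -> Cplx R) : R[i] :=
  if j is Some i then z i ^+ N else 0.

Lemma monomial_bound j N (z : I -> Cplx R) : closed_polydisc R I z ->
  normc (monomial j N z) <= 1.
Proof.
move=> zD; rewrite /monomial; case: j => [i|]; last by rewrite normc0.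
by rewrite normcX exprn_ile1 ?normc_ge0//; have := zD i; rewrite cnormE lecR.
Qed.

Lemma derivable_expr (c : R[i]) N (z : Cplx R) :
  derivable (fun w : Cplx R => c * w ^+ N : Cplx R) z 1.
Proof.
have -> : (fun w : Cplx R => c * w ^+ N : Cplx R) =
    (c : Cplx R) \*: ((@id (Cplx R)) ^+ N : Cplx R -> Cplx R).
  apply/funext => w; congr (_ * _).
  by elim: N => [|N IH]; rewrite ?expr0// exprS IH [in RHS]exprS.
by apply: derivableZ; apply: derivableX; exact: derivable_id.
Qed.

Lemma cvg_complexX {T : Type} {F : set_system T} {FF : Filter F}
    (f : T -> Cplx R) (l : Cplx R) n :
  f @ F --> l -> (fun y => f y ^+ n : Cplx R) @ F --> (l ^+ n : Cplx R).
Proof.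
move=> fl; elim: n => [|n IH].
  by rewrite expr0; under eq_fun do rewrite expr0; exact: cvg_cst.
rewrite exprS; under eq_fun do rewrite exprS.
exact: (cvgM fl IH).
Qed.

Lemma lacunary_polydisc_algebra (e : nat -> R) (j : nat -> option I)
    (N : nat -> nat) :
  (forall k, 0 <= e k) -> (forall k, e k.+1 <= e k / 2) ->
  exists h : polydisc_algebra R I, forall n (z : closed_polydisc R I),
    normc (h z - \sum_(k < n) (e k)%:C%C * monomial (j k) (N k) (set_val z))
      <= 4 * e n.
Proof.
move=> e0 e2.
have term_bound k (z : I -> Cplx R) : closed_polydisc R I z ->
    normc ((e k)%:C%C * monomial (j k) (N k) z) <= e k.
  move=> zD; rewrite Normc.normcM normc_real ger0_norm//.
  by rewrite ler_piMr// monomial_bound.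
have /choice[S HS] : forall z : I -> Cplx R, exists s : Cplx R,
    closed_polydisc R I z -> forall n,
    normc (s - \sum_(k < n) (e k)%:C%C * monomial (j k) (N k) z) <= 4 * e n.
  move=> z; have [zD|nzD] := pselect (closed_polydisc R I z); last by exists 0.
  have [s Hs] := complex_halving_sum e0 e2 (fun k => term_bound k z zD).
  by exists s.
pose f (z : closed_polydisc R I) : Cplx R := S (set_val z).
have cf : continuous f.
  apply: (@continuous_halving_sum R e e0 e2 (closed_polydisc R I)
    (fun k z => (e k)%:C%C * monomial (j k) (N k) (set_val z)) f); last first.
    by move=> n z; apply: HS; exact: set_valP.
  move=> k z.
  suff cm : (fun y : closed_polydisc R I =>
      monomial (j k) (N k) (set_val y) : Cplx R) @ z -->
       (monomial (j k) (N k) (set_val z) : Cplx R).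
    exact: (cvgZl_tmp cm).
  rewrite /monomial; case: (j k) => [i|]; last first.
    exact: (@cst_continuous (closed_polydisc R I) (Cplx R) 0 z).
  have ci : (fun y : closed_polydisc R I => set_val y i : Cplx R) @ z -->
      (set_val z i : Cplx R).
    apply: (@continuous_comp _ {ptws I -> Cplx R} _ set_val (fun z => z i)).
      exact: initial_continuous.
    exact: (@proj_continuous I (fun=> Cplx R) i).
  exact: (@cvg_complexX _ _ (nbhs_filter z) (fun y => set_val y i)
    (set_val z i) (N k) ci).
have hf : separately_holomorphic f.
  move=> z zD i.
  (* half of the distance from [z i] to the circle, so that the disc of radius
     [d] around [z i] is contained in the disc of radius [1 - d] around 0 *)
  pose d := (1 - normc (z i)) / 2.
  have zi : normc (z i) < 1 by have := zD i; rewrite cnormE ltcR.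
  have d0 : 0 < d by rewrite divr_gt0// subr_gt0.
  have near_in w : normc (w - z i) < d -> normc w <= 1 - d.
    move=> wd; rewrite -(subrK (z i) w) (le_trans (le_normcD _ _))//.
    by move: wd; rewrite /d; lra.
  have inD w : normc (w - z i) < d -> closed_polydisc R I (dfwith z i w).
    move=> wd l; have [->|li] := eqVneq i l; rewrite ?dfwithin ?dfwithout//.
      by rewrite cnormE lecR (le_trans (near_in _ wd))// gerBl ltW.
    exact/ltW/zD.
  apply: (@derivable_halving_sum R e e0 e2
    (fun k w => (e k)%:C%C * monomial (j k) (N k) (dfwith z i w)) _ _ d d^-1) => //.
  - by rewrite invr_ge0 ltW.
  - move=> k; case: (j k) => [l|] /=; last first.
      by under eq_fun do rewrite mulr0; exact: derivable_cst.
    have [<-|li] := eqVneq i l.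
      under eq_fun do rewrite dfwithin; exact: derivable_expr.
    under eq_fun do rewrite dfwithout//; exact: derivable_cst.
  - move=> k h hd; rewrite -mulrBr Normc.normcM normc_real ger0_norm//.
    rewrite [d^-1 * _]mulrC -mulrA ler_wpM2l//.
    have dh : 0 <= d^-1 * normc h by rewrite mulr_ge0 ?normc_ge0// invr_ge0 ltW.
    rewrite /monomial; case: (j k) => [l|]; last by rewrite subrr normc0.
    have [<-|li] := eqVneq i l; last first.
      by rewrite !dfwithout// subrr normc0.
    rewrite !dfwithin.
    have -> : d^-1 * normc h = (1 - (1 - d))^-1 * normc (z i + h - z i).
      by congr (_^-1 * normc _); ring.
    apply: normc_subX_le.
    + by apply: near_in; rewrite addrAC subrr add0r.
    + by apply: near_in; rewrite subrr normc0.
    + by rewrite gtrBl.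
  - move=> n w wd.
    have -> : 'valL_0 f (dfwith z i w) = S (dfwith z i w).
      have wD := mem_set (inD w wd).
      by rewrite -[RHS]/(f (SigSub wD)) -{2}(valLK 0 f).
    exact/HS/inD.
have fA : f \in in_polydisc_algebra by apply/asboolP.
by exists (PolydiscAlgebra fA) => n z; apply: HS; exact: set_valP.
Qed.

End Lacunary.

(** * The open sets of steep functions *)

Section Steep.
Context {R : realType} {I : countType}.
Local Notation A := (polydisc_algebra R I).
Implicit Types (f g : A) (th v : I -> R).

(** A boolean selects the part, so that real and imaginary parts are treated
    together: on the circle they only differ by a quarter turn. *)
Definition complex_part (b : bool) (w : R[i]) : R :=
  if b then complex.Im w else complex.Re w.

Lemma complex_partD b (w x : R[i]) :
  complex_part b (w + x) = complex_part b w + complex_part b x.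
Proof. by case: b; rewrite /complex_part raddfD. Qed.

Lemma complex_partB b (w x : R[i]) :
  complex_part b (w - x) = complex_part b w - complex_part b x.
Proof. by case: b; rewrite /complex_part raddfB. Qed.

Lemma complex_part_le b (w : R[i]) : `|complex_part b w| <= normc w.
Proof. by case: b; [exact: normc_geIm|exact: normc_geRe]. Qed.

Lemma complex_part_expi b (r a : R) :
  complex_part b (r%:C%C * expi a) = r * cos (a - b%:R * (pi / 2)).
Proof.
case: b => /=; first by rewrite mul0r addr0 mul1r -sin_cosBpihalf.
by rewrite !mul0r !subr0.
Qed.

Definition shift_torus th v (t : R) : closed_polydisc R I :=
  torus_point (fun i => th i + t * v i).

Definition increment b f th v t : R :=
  complex_part b (f (shift_torus th v t)) - complex_part b (f (torus_point th)).

(** The margin [d] makes the condition stable under small perturbations. It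
    also excludes [t = 0]; and since [f] is bounded, so is [n * |t|], so that
    steepness for large [n] concerns small [t]. *)
Definition steep (n : nat) (j : I) : set A := [set f |
  exists2 d : R, 0 < d & forall b th v, (forall i, `|v i| <= 1) ->
    2^-1 <= `|v j| -> exists t, n%:R * `|t| + d <= `|increment b f th v t|].

Lemma increment_dist b f g th v t :
  `|increment b f th v t - increment b g th v t| <= 2 * `|f - g|.
Proof.
have H z : `|complex_part b (f z) - complex_part b (g z)| <= `|f - g|.
  rewrite -complex_partB (le_trans (complex_part_le _ _))//.
  exact: (supnorm_ge (f - g) z).
have -> : increment b f th v t - increment b g th v t =
    (complex_part b (f (shift_torus th v t)) - complex_part b (g (shift_torus th v t)))
    - (complex_part b (f (torus_point th)) - complex_part b (g (torus_point th))).
  by rewrite /increment; ring.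
by rewrite (le_trans (ler_normB _ _))// mulr_natl mulr2n lerD.
Qed.

Lemma open_steep n j : open (steep n j).
Proof.
rewrite openE => f [d d0 Hd]; apply/nbhs_normP; exists (d / 4).
  by rewrite /= divr_gt0.
move=> g; rewrite /ball_/= => fg; exists (d / 2); first by rewrite divr_gt0.
move=> b th v v1 vj; have [t Ht] := Hd b th v v1 vj; exists t.
have := increment_dist b f g th v t.
have := ler_normD (increment b f th v t - increment b g th v t) (increment b g th v t).
by rewrite subrK; lra.
Qed.

Lemma increment_le b f th v t : `|increment b f th v t| <= 2 * `|f|.
Proof.
have H z : `|complex_part b (f z)| <= `|f|.
  exact: le_trans (complex_part_le _ _) (supnorm_ge f z).
by rewrite (le_trans (ler_normB _ _))// mulr_natl mulr2n lerD.
Qed.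

(** The supremum may not be attained, whence the 1/2. *)
Lemma linfty_norm1 v : linfty_norm v = 1%E ->
  (forall i, `|v i| <= 1) /\ exists j, 2^-1 <= `|v j|.
Proof.
move=> v1; split=> [i|].
  by rewrite -lee_fin -v1; apply: ereal_sup_ubound; exists i.
have : (2^-1%:E < ereal_sup [set `|v i|%:E | i in [set: I]])%E.
  by rewrite -/(linfty_norm v) v1 lte_fin invf_lt1// ltr1n.
by move=> /ereal_sup_gt[_ [j _ <-]]; rewrite lte_fin => /ltW; exists j.
Qed.

(** If the difference quotient has limit [l], it is less than [|l| + 1] in
    modulus for [0 < |t| < r], with some [r > 0]. For [n] larger than [|l| + 1 + 2 * |f| / r], the step [t]
    given by steepness satisfies [n * |t| < 2 * |f|], hence [|t| < r], and the
    quotient is at least [n] there. *)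
Lemma steep_not_differentiable f b th v : (forall n j, steep n j f) ->
  linfty_norm v = 1%E ->
  ~ differentiable_along (fun th => complex_part b (f (torus_point th))) th v.
Proof.
move=> fS /linfty_norm1[v1 [j vj]] /cvg_ex[l /= /cvgrPdist_lt /(_ 1 ltr01)].
rewrite near_withinE => /nbhs_normP[r /= r0 Hr].
have fr : 0 <= 2 * `|f| / r by rewrite divr_ge0 ?mulr_ge0// ltW.
pose n := (Num.truncn (`|l| + 1 + 2 * `|f| / r)).+1.
have nl : `|l| + 1 + 2 * `|f| / r < n%:R by exact: truncnS_gt.
have l0 : 0 <= `|l| + 1 by rewrite addr_ge0.
have nR : 0 < n%:R :> R by rewrite ltr0n.
have [d d0 /(_ b th v v1 vj)[t Ht]] := fS n j.
have := increment_le b f th v t => Hle.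
have t0 : t != 0.
  apply: contraTneq Ht => ->; rewrite normr0 mulr0 add0r -ltNge.
  suff -> : increment b f th v 0 = 0 by rewrite normr0.
  rewrite /increment /shift_torus.
  by under eq_fun do rewrite mul0r addr0; rewrite subrr.
have tr : `|t| < r.
  rewrite -(ltr_pM2l nR); apply: lt_le_trans (_ : 2 * `|f| <= _).
    by apply: lt_le_trans Hle; apply: lt_le_trans Ht; rewrite ltrDl.
  by rewrite -ler_pdivrMr// ltW// (le_lt_trans _ nl)// lerDr.
have := Hr t; rewrite /ball_/= sub0r normrN => /(_ tr t0).
rewrite -/(increment b f th v t).
have : n%:R <= `|increment b f th v t / t|.
  rewrite normrM normfV ler_pdivlMr ?normr_gt0// (le_trans _ Ht)// lerDl.
  exact: ltW.
move: (increment b f th v t / t) => q.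
by have := ler_normB l (l - q); rewrite subKr; lra.
Qed.

End Steep.

(** * Density *)

Section Construction.
Context {R : realType} {I : countType}.
Local Notation A := (polydisc_algebra R I).

(** Each exponent may be required to exceed a quantity that depends on the
    weighted sum of the previous ones, which in the construction bounds the
    Lipschitz constant of a partial sum on the torus. *)
Lemma fast_growing_exists (Phi : nat -> R -> R) (w : nat -> R) :
  exists N : nat -> nat, forall k, Phi k (\sum_(l < k) w l * (N l)%:R) < (N k)%:R.
Proof.
pose next k P := (Num.truncn (Phi k P)).+1.
pose P := fix P k : R := if k is l.+1 then P l + w l * (next l (P l))%:R else 0.
exists (fun k => next k (P k)) => k.
suff -> : \sum_(l < k) w l * (next l (P l))%:R = P k by exact: truncnS_gt.
elim: k => [|k IH]; first by rewrite big_ord0.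
by rewrite big_ord_recr/= IH.
Qed.

Lemma monomial_torus_lipschitz (j : option I) N (th v : I -> R) t :
  (forall i, `|v i| <= 1) ->
  normc (monomial j N (set_val (shift_torus th v t)) -
         monomial j N (set_val (torus_point th))) <= 2 * `|t| * N%:R.
Proof.
move=> v1; rewrite /monomial; case: j => [i|]; last first.
  by rewrite subrr normc0 !mulr_ge0.
rewrite -/(expi (th i + t * v i)) -/(expi (th i)) !expiX.
apply: le_trans (expi_lipschitz _ _) _.
rewrite -mulrBr addrAC subrr add0r !normrM -mulrA ler_wpM2l//.
by rewrite normr_nat mulrC ler_wpM2r// ler_piMr.
Qed.

Lemma ler_norm_last (x1 x2 x3 x4 y : R) :
  `|y| <= `|x1 + x2 + x3 - x4 + y| + `|x1| + `|x2| + `|x3| + `|x4|.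
Proof.
have {1}-> : y = (x1 + x2 + x3 - x4 + y) - x1 - x2 - x3 + x4 by ring.
apply: le_trans (ler_normD _ _) _; rewrite lerD2r.
do 3![apply: le_trans (ler_normB _ _) _; rewrite ?lerD2r]; exact: lexx.
Qed.

(** Near [g] there is [g + h], with [h] a lacunary series whose [k]-th term
    dominates all the others at the scale [1 / N k] and thereby takes care of the
    pair of a coordinate and a slope coded by [k]. *)
Lemma steep_dense (g : A) (c : R) : 0 < c ->
  exists2 f : A, `|g - f| < c & forall n j, steep n j f.
Proof.
move=> c0; pose e k : R := c / 8 / 32 ^+ k.
have e0 k : 0 < e k by rewrite divr_gt0 ?exprn_gt0// divr_gt0.
have e0' k := ltW (e0 k).
have eS k : e k.+1 = e k / 32 by rewrite /e exprSr invfM mulrA.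
have e2 k : e k.+1 <= e k / 2 by rewrite eS; have := e0 k; lra.
have /choice[r Hr] : forall k, exists r, 0 < r /\
    forall th th' : I -> R, (forall i, `|th' i - th i| <= r) ->
      normc (g (torus_point th') - g (torus_point th)) < e k / 16.
  move=> k; have ek : 0 < e k / 16 by rewrite divr_gt0.
  by have [r r0 Hr] := torus_uniform_continuity (@pda_continuous _ _ g) ek; exists r.
pose jn k : option (I * nat) := unpickle k.
pose j k := omap fst (jn k).
pose n k := oapp snd 0%N (jn k).
(* The three summands ensure that for [|t| <= 4 / N k] the increments of [g] and
   of the earlier terms are at most [e k / 16], and that [n k * |t|] is at most
   [e k / 4]. *)
have [N HN] := fast_growing_exists (fun k P =>
  4 / r k + 16 * (n k)%:R / e k + 128 * P / e k) e.
have [h Hh] := @lacunary_polydisc_algebra R I e j N e0' e2.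
exists (g + h).
  have : `|h| <= c / 2.
    apply: supnorm_le => z; have := Hh 0%N z; rewrite big_ord0 subr0 /e expr0.
    by lra.
  by rewrite opprD addrA subrr add0r normrN => H; rewrite (le_lt_trans H)//; lra.
move=> n0 j0; pose k := pickle (j0, n0).
have jk : j k = Some j0 by rewrite /j /jn /k pickleK.
have nk : n k = n0 by rewrite /n /jn /k pickleK.
exists (e k / 8); first by rewrite divr_gt0.
move=> b th v v1 vj.
have := HN k; rewrite nk; set P := \sum_(l < k) e l * (N l)%:R => HNk.
have P0 : 0 <= P by apply: sumr_ge0 => l _; rewrite mulr_ge0.
have [r0 Hrk] := Hr k.
have A1 : 0 <= 4 / r k by rewrite divr_ge0// ltW.
have A2 : 0 <= 16 * n0%:R / e k by rewrite divr_ge0// mulr_ge0.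
have A3 : 0 <= 128 * P / e k by rewrite divr_ge0// mulr_ge0.
have N0 : 0 < (N k)%:R :> R by apply: le_lt_trans HNk; rewrite !addr_ge0.
have [s s1 Hs] := cos_swing ((N k)%:R * th j0 - b%:R * (pi / 2)).
have nv0 : 0 < `|v j0| by rewrite (lt_le_trans _ vj)// invr_gt0.
have vj0 : v j0 != 0 by rewrite -normr_gt0.
(* the step that turns the [N k]-th power of the [j0]-th coordinate by
   [s * pi / 2] *)
pose t := s * (pi / 2) / ((N k)%:R * v j0).
have tN : `|t| * (N k)%:R <= 4.
  rewrite /t 2!normrM s1 mul1r normfV [in X in _ / X]normrM normr_nat.
  rewrite ger0_norm ?divr_ge0 ?pi_ge0//.
  have -> : pi / 2 / ((N k)%:R * `|v j0|) * (N k)%:R = pi / 2 / `|v j0|.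
    by field; rewrite !lt0r_neq0.
  rewrite ler_pdivrMr//.
  by have := @pihalf_lt2 R; lra.
have T1 : `|t| <= r k.
  have : 4 / r k < (N k)%:R by lra.
  by rewrite ltr_pdivrMr// -(ler_pM2r N0); lra.
have T2 : n0%:R * `|t| <= e k / 4.
  have : 16 * n0%:R / e k < (N k)%:R by lra.
  rewrite ltr_pdivrMr// -(ler_pM2r N0).
  have : n0%:R * (`|t| * (N k)%:R) <= n0%:R * 4 by rewrite ler_wpM2l.
  by lra.
have T3 : 2 * `|t| * P <= e k / 16.
  have : 128 * P / e k < (N k)%:R by lra.
  rewrite ltr_pdivrMr// -(ler_pM2r N0).
  have : P * (`|t| * (N k)%:R) <= P * 4 by rewrite ler_wpM2l.
  by lra.
exists t.
pose term l (z : closed_polydisc R I) :=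
  (e l)%:C%C * monomial (j l) (N l) (set_val z).
pose z' := shift_torus th v t; pose z := torus_point th.
have Dg : normc (g z' - g z) <= e k / 16.
  apply/ltW/Hrk => i; rewrite addrAC subrr add0r normrM.
  by rewrite (le_trans _ T1)// ler_piMr.
have Dlow : normc (\sum_(l < k) term l z' - \sum_(l < k) term l z) <= e k / 16.
  apply: le_trans T3; rewrite /P; elim: (k) => [|m IH].
    by rewrite !big_ord0 subrr normc0 mulr0.
  rewrite !big_ord_recr/= mulrDr opprD addrACA (le_trans (le_normcD _ _))// lerD//.
  rewrite -mulrBr Normc.normcM normc_real ger0_norm// mulrCA ler_wpM2l//.
  exact: monomial_torus_lipschitz.
have Dk : e k <= `|complex_part b (term k z' - term k z)|.
  rewrite complex_partB /term jk /monomial.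
  rewrite -/(expi (th j0)) -/(expi (th j0 + t * v j0)) !expiX.
  rewrite !complex_part_expi -mulrBr normrM ger0_norm// ler_peMr//.
  have -> : (N k)%:R * (th j0 + t * v j0) - b%:R * (pi / 2) =
      (N k)%:R * th j0 - b%:R * (pi / 2) + s * (pi / 2).
    by rewrite /t; field; rewrite vj0 lt0r_neq0.
  exact: Hs.
have tail y : normc (h y - \sum_(l < k.+1) term l y) <= e k / 8.
  by apply: le_trans (Hh k.+1 y) _; rewrite eS; have := e0 k; lra.
(* The last summand has modulus at least [e k]; the four others together at most
   [3 * e k / 8], which leaves [5 * e k / 8 >= n0 * |t| + e k / 8]. *)
have -> : increment b (g + h) th v t = complex_part b (g z' - g z)
    + complex_part b (\sum_(l < k) term l z' - \sum_(l < k) term l z)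
    + complex_part b (h z' - \sum_(l < k.+1) term l z')
    - complex_part b (h z - \sum_(l < k.+1) term l z)
    + complex_part b (term k z' - term k z).
  rewrite /increment -[pda_fun (g + h) _]/(g z' + h z').
  rewrite -[pda_fun (g + h) _]/(g z + h z).
  rewrite !big_ord_recr/= !(complex_partB, complex_partD); ring.
have := ler_norm_last (complex_part b (g z' - g z))
  (complex_part b (\sum_(l < k) term l z' - \sum_(l < k) term l z))
  (complex_part b (h z' - \sum_(l < k.+1) term l z'))
  (complex_part b (h z - \sum_(l < k.+1) term l z))
  (complex_part b (term k z' - term k z)).
have := le_trans (complex_part_le b _) Dg.
have := le_trans (complex_part_le b _) Dlow.
have := le_trans (complex_part_le b _) (tail z').
have := le_trans (complex_part_le b _) (tail z).
have := e0 k; move: Dk; lra.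
Qed.

End Construction.

(** * Residuality of nowhere directionally differentiable functions *)

Theorem theorem3p1 (R : realType) (I : countType) :
  (exists f : polydisc_algebra R I, nowhere_directionally_differentiable f) /\
  residual [set f : polydisc_algebra R I |
    nowhere_directionally_differentiable f].
Proof.
have nowhere (f : polydisc_algebra R I) : (forall n j, steep n j f) ->
    nowhere_directionally_differentiable f.
  move=> fS th v v1; split.
    exact: (@steep_not_differentiable _ _ f false).
  exact: (@steep_not_differentiable _ _ f true).
split.
  have [f _ fS] := @steep_dense R I 0 1 ltr01.
  by exists f; exact: nowhere.
exists [set f | forall n j, steep n j f]; split; last exact: nowhere.
- exists (fun m => if unpickle m is Some (j, n) then steep n j else setT).
    move=> m; case: (unpickle m) => [[j n]|]; last exact: openT.
    exact: open_steep.
  apply/seteqP; split=> f /= fS.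
    by move=> m _; case: (unpickle m) => [[j n]|] //; exact: fS.
  by move=> n j; have := fS (pickle (j, n)) Logic.I; rewrite pickleK.
- move=> O [g Og]; rewrite openE => /(_ g Og)/nbhs_normP[c /= c0 cO].
  by have [f gf fS] := steep_dense g c0; exists f; split=> //; exact: cO.
Qed.
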